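(* For every $x\in[0,1]$, \[ \max\{\psi(C) : C\in\mathcal{C},\ \xi(C)=x\}=\sqrt{x}, \] and the maximum is attained uniquely by the Fréchet copula $C^{\mathrm{Fr}}_\alpha(u,v)=(1-\alpha)uv+\alpha\min(u,v)$ with $\alpha=\sqrt{x}$. In particular, $\psi(C)\le\sqrt{\xi(C)}$ for every bivariate copula $C$.
   Context: $\mathcal{C}$ denotes the set of all bivariate copulas, i.e. distribution functions on $[0,1]^2$ with standard uniform marginals. For $C\in\mathcal{C}$, Chatterjee's rank correlation is $\xi(C)=6\int_0^1\int_0^1(\partial_1C(u,v))^2\,du\,dv-2$ (partial derivatives exist a.e.), and Spearman's footrule is $\psi(C)=6\int_0^1 C(u,u)\,du-2$. *)

(* Defs.v *)
From HB Require Import structures.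
From mathcomp Require Import all_boot all_order all_algebra.
From mathcomp Require Import all_classical all_reals all_analysis.
Set Implicit Arguments. Unset Strict Implicit. Unset Printing Implicit Defensive.
Import Order.TTheory GRing.Theory Num.Theory.
Import numFieldNormedType.Exports.
Local Open Scope classical_set_scope.
Local Open Scope ring_scope.

Section Copulas.
Variable R : realType.

(* A bivariate copula, given as a function R -> R -> R; only its values on
   [0,1]^2 matter. *)
Definition is_copula (C : R -> R -> R) : Prop :=
  [/\ (forall u, 0 <= u <= 1 -> C u 0 = 0 /\ C 0 u = 0),
      (forall u, 0 <= u <= 1 -> C u 1 = u /\ C 1 u = u) &
      (forall u1 u2 v1 v2, 0 <= u1 -> u1 <= u2 -> u2 <= 1 ->
         0 <= v1 -> v1 <= v2 -> v2 <= 1 ->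
         C u1 v1 - C u1 v2 - C u2 v1 + C u2 v2 >= 0)].

(* Partial derivative in the first argument (derive1 returns the library's
   default value where it does not exist, which happens only on a null set). *)
Definition partial1 (C : R -> R -> R) (u v : R) : R :=
  derive1 (fun t => C t v) u.

Definition leb := (@lebesgue_measure R).

Definition chatterjee_xi (C : R -> R -> R) : R :=
  6 * fine (\int[leb]_(v in `[0%R, 1%R]) \int[leb]_(u in `[0%R, 1%R])
              ((partial1 C u v) ^+ 2)%:E)%E - 2.

Definition footrule_psi (C : R -> R -> R) : R :=
  6 * fine (\int[leb]_(u in `[0%R, 1%R]) (C u u)%:E)%E - 2.

Definition frechet (alpha : R) (u v : R) : R :=
  (1 - alpha) * u * v + alpha * Num.min u v.

End Copulas.

(* Main.v *)
(* The sections t |-> C t v of a copula are nondecreasing and 1-Lipschitz, so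
   each has a density k_v with values in [0, 1] that agrees a.e. with the
   partial derivative of C, and C u v = \int_0^u k_v.  Let s_v be the indicator
   of [0, v].  For every real a, the expansion of
     0 <= \int_0^1 (k_v u - v - a (s_v u - v))^2 du
   involves only \int k_v^2, C v v and v; integrating it over v gives
     0 <= xi C - 2 a psi C + a^2.
   The choice a = psi C yields psi^2 <= xi.  If psi = a and xi = a^2, then for
   a.e. v the square vanishes a.e., hence k_v = (1 - a) v + a s_v and
   C u v = frechet a u v for all u; continuity in v gives every v. *)
Require Import Defs.
From HB Require Import structures.
From mathcomp Require Import all_boot all_order all_algebra.
From mathcomp Require Import all_classical all_reals all_analysis.
From mathcomp Require Import ring lra.
From mathcomp Require Import measurable_realfun.
Set Implicit Arguments.
Unset Strict Implicit.
Unset Printing Implicit Defensive.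
Import Order.TTheory GRing.Theory Num.Theory.
Import numFieldNormedType.Exports.
Local Open Scope classical_set_scope.
Local Open Scope ring_scope.

(** * Comparing integrals of possibly non-measurable functions *)

Section ae_integral_nonmeasurable.
Context d (T : measurableType d) (R : realType) (mu : {measure set T -> \bar R}).
Local Open Scope ereal_scope.
Import HBNNSimple.

(** The integral of a nonnegative function is a supremum over the simple functions below it, and a
    larger function only enlarges that family. *)
Lemma ge0_le_integral_nonmeasurable (D : set T) (f g : T -> \bar R) :
  (forall x, D x -> 0 <= f x) -> (forall x, D x -> f x <= g x) ->
  \int[mu]_(x in D) f x <= \int[mu]_(x in D) g x.
Proof.
move=> f0 fg.
have g0 x : D x -> 0 <= g x by move=> Dx; exact: le_trans (f0 _ Dx) (fg _ Dx).
rewrite !ge0_integralE// ge_ereal_sup// => _ [h/= hf] <-.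
apply: ereal_sup_ubound; exists h => // x; apply: (le_trans (hf x)).
exact: lee_restrict.
Qed.

(* Contrary to [ge0_ae_eq_integral], [f] need not be measurable: Borel
   measurability of a derivative extended by a default value is not at hand. *)
Lemma ge0_ae_eq_integral_nonmeasurable (D N : set T) (f g : T -> \bar R) :
  measurable D -> measurable N -> mu N = 0 -> measurable_fun D g ->
  (forall x, D x -> 0 <= f x) -> (forall x, D x -> 0 <= g x) ->
  (forall x, D x -> ~ N x -> f x = g x) ->
  \int[mu]_(x in D) f x = \int[mu]_(x in D) g x.
Proof.
move=> mD mN N0 mg f0 g0 fg; apply/eqP; rewrite eq_le; apply/andP; split.
  (* A simple [h] below [f] is measurable, so its values on the null set [N] can be discarded; off
     [N] it lies below [g]. *)
  rewrite ge0_integralE// ge_ereal_sup// => _ [h/= hf] <-.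
  have mh A : measurable_fun A (EFin \o h).
    by apply/measurable_EFinP; exact: measurable_funTS.
  rewrite -integralT_nnsfun (ge0_negligible_integral mN)//; last first.
    by move=> x _; rewrite lee_fin.
  rewrite (ge0_negligible_integral mN mD mg g0 N0).
  rewrite (integral_mkcond (setT `\` N)) (integral_mkcond (D `\` N)).
  apply: ge0_le_integral_nonmeasurable => x _ /=.
    by rewrite patchE; case: ifP => // _; rewrite lee_fin.
  rewrite !patchE !in_setD in_setT /=.
  have [xN|xN] := boolP (x \in N); first by rewrite andbF.
  rewrite /= andbT; apply: (le_trans (hf x)); rewrite patchE.
  case: ifPn => // xD; rewrite fg//; first exact: set_mem.
  by move/mem_set; apply/negP.
rewrite (ge0_negligible_integral mN mD mg g0 N0) integral_mkcond.
rewrite [leRHS]integral_mkcond; apply: ge0_le_integral_nonmeasurable => x _.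
  by rewrite patchE; case: ifPn => // /set_mem[Dx _]; exact: g0.
rewrite !patchE; case: ifPn => [/set_mem[Dx Nx]|_].
  by rewrite mem_set// fg.
by case: ifPn => // /set_mem; exact: f0.
Qed.

End ae_integral_nonmeasurable.

(** * Almost-everywhere derivatives of monotone 1-Lipschitz functions *)

Section lipschitz_density.
Context {R : realType}.
Notation mu := (@lebesgue_measure R).

Lemma lebesgue_aeS (P Q : R -> Prop) : (forall x, P x -> Q x) ->
  {ae mu, forall x, P x} -> {ae mu, forall x, Q x}.
Proof. exact: (@filterS _ _ (ae_filter_ringOfSetsType mu) P Q). Qed.

Lemma lebesgue_ae_cc01 (P : R -> Prop) :
  {ae mu, forall x : R, 0 < x < 1 -> P x} ->
  {ae mu, forall x : R, 0 <= x <= 1 -> P x}.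
Proof.
move=> [N [mN N0 HN]].
have m1 (r : R) : measurable ([set r] : set (measurableTypeR R)).
  exact: (measurable_set1 r).
have m01 := measurableU _ _ (m1 0) (m1 1).
exists (N `|` ([set 0] `|` [set 1])); split.
- exact: measurableU.
- rewrite measureU0//.
  by rewrite measureU0; [exact: lebesgue_measure_set1|exact: m1|exact: m1|
    exact: lebesgue_measure_set1].
- move=> x /= /not_implyP[/andP[x0 x1] nP].
  have [->|x0'] := eqVneq x 0; first by right; left.
  have [->|x1'] := eqVneq x 1; first by right; right.
  left; apply: HN => /= H; apply: nP; apply: H.
  by rewrite !lt_neqAle x0 x1 eq_sym x0' x1'.
Qed.

(** Steps of length [1/(n+1)] turn the derivative into a sequential limit, the form needed for
    dominated convergence. *)
Lemma is_derive_cvg_quotient (F : R -> R) (x l : R) : is_derive x 1 F l ->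
  n.+1%:R * (F (x + n.+1%:R^-1) - F x) @[n --> \oo] --> l.
Proof.
move=> dF; have /cvg_ex[l' Hl'] := @ex_derive _ _ _ _ _ _ _ dF.
have ll' : l' = l by rewrite -(@derive_val _ _ _ _ _ _ _ dF); apply/esym/cvg_lim.
rewrite {}ll' in Hl'.
have/cvgr_dnbhsP/(_ (fun n => n.+1%:R^-1)) := Hl'.
have -> : (fun n : nat => n.+1%:R * (F (x + n.+1%:R^-1) - F x)) =
   (fun n : nat => n.+1%:R^-1^-1 *: ((F \o shift x) (n.+1%:R^-1 *: 1) - F x)).
  by apply/funext => n; rewrite /= invrK /GRing.scale/= mulr1 [x + _]addrC.
apply; split; first by move=> n; rewrite invr_eq0.
exact: cvg_harmonic.
Qed.

Lemma is_derive_monotone_lipschitz (F : R -> R) (x l : R) :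
  {homo F : x y / x <= y} -> (forall x y, x <= y -> F y - F x <= y - x) ->
  is_derive x 1 F l -> 0 <= l <= 1.
Proof.
move=> Fnd Flip /is_derive_cvg_quotient Hl.
have xn n : x <= x + n.+1%:R^-1 by rewrite lerDl.
apply/andP; split.
  rewrite -(cvg_lim _ Hl)//; apply: limr_ge; first by apply/cvg_ex; exists l.
  by apply: nearW => n; rewrite mulr_ge0// subr_ge0 Fnd.
rewrite -(cvg_lim _ Hl)//; apply: limr_le; first by apply/cvg_ex; exists l.
apply: nearW => n.
rewrite (le_trans (ler_wpM2l _ (Flip _ _ (xn n))))//.
by rewrite addrAC subrr add0r divff.
Qed.

Variable F : R -> R.
Hypothesis Fnd : {homo F : x y / x <= y}.
Hypothesis Flip : forall x y, x <= y -> F y - F x <= y - x.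

Lemma monotone_lipschitz_continuous : continuous F.
Proof.
move=> x; apply/cvgrPdist_le => e e0; near=> y.
have xy : `|x - y| <= e by near: y; exact: cvgr_dist_le.
apply: le_trans xy; have [h|/ltW h] := leP x y.
  by rewrite ler0_norm ?subr_le0 ?Fnd// ler0_norm ?subr_le0// !opprB Flip.
by rewrite ger0_norm ?subr_ge0 ?Fnd// ger0_norm ?subr_ge0// Flip.
Unshelve. all: by end_near. Qed.

Let F_rc : right_continuous F.
Proof. exact/right_continuousW/monotone_lipschitz_continuous. Qed.

HB.instance Definition _ := isCumulative.Build R _ R F Fnd F_rc.

Let G x := x - F x.

Let G_nd : {homo G : x y / x <= y}.
Proof. by move=> x y /Flip; rewrite /G; lra. Qed.

Let G_rc : right_continuous G.
Proof.
apply: right_continuousW => x.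
by apply: cvgB; [exact: cvg_id|exact: monotone_lipschitz_continuous].
Qed.

HB.instance Definition _ := isCumulative.Build R _ R G G_nd G_rc.

Let lsF := lebesgue_stieltjes_measure F.
Let lsG := lebesgue_stieltjes_measure G.

Let ls_oc (f : cumulative R R) a b : a <= b ->
  lebesgue_stieltjes_measure f `]a, b] = (f b - f a)%:E.
Proof.
move=> ab; rewrite /lebesgue_stieltjes_measure /measure_extension.
by rewrite measurable_mu_extE/= ?wlength_itv_bnd//; exact: is_ocitv.
Qed.

(* x - F x is again nondecreasing, so its Stieltjes measure is the missing
   part of the Lebesgue measure. *)
Let ls_dominated (A : set (measurableTypeR R)) : measurable A ->
  (lsF A <= mu A)%E.
Proof.
move=> mA; have -> : mu A = measure_add lsF lsG A.
  apply: lebesgue_measure_unique mA => X [[a b] _ <-]/=; rewrite [RHS]measure_addE.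
  have [ab|ba] := leP a b; last first.
    by rewrite set_itv_ge ?measure0 ?adde0// bnd_simp ltNge ltW.
  have -> : mu `]a, b] = (b - a)%:E by exact: (ls_oc idfun).
  transitivity ((F b - F a)%:E + (G b - G a)%:E)%E.
    by rewrite -EFinD; congr EFin; rewrite /G; lra.
  by congr (_ + _)%E; apply/esym; [exact: (ls_oc F)|exact: (ls_oc G)].
by rewrite measure_addE leeDl.
Qed.

Let lsF01 : (lsF `[0%R, 1%R] < +oo)%E.
Proof.
rewrite (le_lt_trans (ls_dominated (measurable_itv _)))//=.
by rewrite lebesgue_measure_itv/= lte01 ltry.
Qed.

Let m01 : measurable (`[0%R, 1%R] : set (measurableTypeR R)) := measurable_itv _.

(** The Stieltjes measure of [F] may be infinite on the line; its restriction to [0, 1] is finite,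
    and Radon-Nikodym is applied to that. *)
Let nu := mfrestr m01 lsF01.

Let nu_mu : nu `<< mu.
Proof.
apply/null_content_dominatesP => A mA A0; apply/eqP; rewrite eq_le measure_ge0 andbT.
rewrite -A0 (le_trans _ (ls_dominated mA))//.
by apply: le_measure; rewrite ?inE//; exact: measurableI.
Qed.

(** Radon-Nikodym gives a density, and Lebesgue differentiation identifies it a.e. with the
    derivative of [F]. *)
Lemma monotone_lipschitz_density : exists k : R -> R,
  [/\ measurable_fun [set: R] k, (forall x, 0 <= k x <= 1),
      (forall x, 0 <= x <= 1 ->
         (\int[mu]_(t in `[0%R, x]) (k t)%:E = (F x - F 0)%:E)%E) &
      {ae mu, forall x : R, 0 < x < 1 -> is_derive x 1 F (k x)}].
Proof.
have [g [g0 gfin gint gE]] := radon_nikodym_sigma_finite nu_mu.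
pose f : R -> R := fine \o g.
have fg : EFin \o f = g by apply/funext => x; rewrite /f/= fineK.
have fint : mu.-integrable setT (EFin \o f) by rewrite fg.
have mf : measurable_fun [set: R] f.
  by apply/measurable_EFinP; apply: (measurable_int mu); exact: fint.
have fE x : 0 <= x <= 1 -> (\int[mu]_(t in `]0%R, x]) (f t)%:E = (F x - F 0)%:E)%E.
  move=> /andP[x0 x1]; under eq_integral do rewrite -[(f _)%:E]/((EFin \o f) _) fg.
  rewrite -gE//= /nu/= /mfrestr/mrestr.
  rewrite (_ : _ `&` _ = `]0%R, x]%classic); last first.
    apply/seteqP; split => t /=; rewrite !in_itv/=; first by case.
    by move=> /andP[t0 tx]; split; rewrite ?t0//= ltW//= (le_trans tx).
  by rewrite /lsF ls_oc.
have dF : {ae mu, forall x : R, 0 < x < 1 -> is_derive x 1 F (f x)}.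
  have fintS y : mu.-integrable `]0%R, y] (EFin \o f) by exact: integrableS fint.
  have := @FTC1 R f (BRight 0) fintS (open_integrable_locally openT fint).
  apply: lebesgue_aeS => x H /andP[x0 x1].
  have [|dH H'] := H; first by [].
  (* The primitive of [f] agrees with [F - F 0] only on [0, 1], hence the restriction to a
     neighbourhood of an interior point. *)
  have Hnear : {near x, (fun y => (\int[mu]_(t in `]0%R, y]) f t)%R + F 0) =1 F}.
    near=> y; rewrite /Rintegral fE/= ?subrK//.
    by apply/andP; split; near: y; [exact: lt_le_nbhsr|exact: lt_le_nbhsl].
  have dH' : is_derive x 1 (fun y => (\int[mu]_(t in `]0%R, y]) f t)%R) (f x).
    by split => //; rewrite -derive1E.
  have dHF : is_derive x 1 (fun y => (\int[mu]_(t in `]0%R, y]) f t)%R + F 0) (f x).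
    by apply: is_derive_eq; rewrite addr0.
  split; first exact: near_eq_derivable Hnear (@ex_derive _ _ _ _ _ _ _ dHF).
  rewrite -(@derive_val _ _ _ _ _ _ _ dHF); apply/esym/near_eq_derive.
  exact: Hnear.
(* Truncation makes the bounds hold everywhere; it changes nothing where [F] has derivative [f x],
   since such a derivative already lies in [0, 1]. *)
pose k x := Num.max 0 (Num.min 1 (f x)).
have mk : measurable_fun setT k.
  apply: measurable_maxr; first exact: measurable_cst.
  by apply: measurable_minr => //; exact: measurable_cst.
have k01 x : 0 <= k x <= 1.
  by rewrite /k le_max lexx /= ge_max ler01 /= ge_min lexx.
have dk : {ae mu, forall x : R, 0 < x < 1 -> is_derive x 1 F (f x) /\ k x = f x}.
  apply: lebesgue_aeS dF => x H /H dFx; split => //.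
  have /andP[f0 f1] := is_derive_monotone_lipschitz Fnd Flip dFx.
  by rewrite /k min_r// max_r.
exists k; split => //.
  move=> x x01; rewrite -fE// -(@integral_itv_obnd_cbnd _ 0); last first.
    by apply/measurable_EFinP; exact: measurable_funTS.
  (* [dk] says nothing at 1, so the right endpoint is dropped too. *)
  rewrite -!(@integral_itv_bndo_bndc _ _ x); first last.
  - by apply/measurable_EFinP; exact: measurable_funTS.
  - by apply/measurable_EFinP; exact: measurable_funTS.
  apply: ae_eq_integral => //; try by apply/measurable_EFinP; exact: measurable_funTS.
  apply: lebesgue_aeS dk => y H /=; rewrite in_itv/= => /andP[y0 yx].
  by case: H => [|_ -> //]; rewrite y0 (lt_le_trans yx)//; case/andP: x01.
by apply: lebesgue_aeS dk => x H /H[+ ->].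
Unshelve. all: by end_near. Qed.

End lipschitz_density.

(** * Sections of a copula and their densities *)

Section copula_density.
Context {R : realType}.
Notation mu := (@lebesgue_measure R).

(* The Lebesgue measure lives on [measurableTypeR R], whose display differs
   from the one that [measurable_itv] is stated with. *)
Lemma measurable_cc (a b : R) :
  measurable (`[a, b] : set (measurableTypeR R)).
Proof. exact: measurable_itv. Qed.

(** Precomposition with this map extends a section by constants outside [0, 1], so that results on
    monotone Lipschitz functions on the line apply. *)
Definition clamp (x : R) : R := Num.max 0 (Num.min 1 x).

Lemma clamp01 x : 0 <= clamp x <= 1.
Proof. by rewrite /clamp le_max lexx /= ge_max ler01 /= ge_min lexx. Qed.

Lemma clamp_id x : 0 <= x <= 1 -> clamp x = x.
Proof. by move=> /andP[x0 x1]; rewrite /clamp min_r// max_r. Qed.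

Lemma clamp_homo : {homo clamp : x y / x <= y}.
Proof.
move=> x y xy; rewrite /clamp.
by have [?|?] := leP 1 x; have [?|?] := leP 1 y; rewrite ?(max_r ler01);
  have [?|?] := leP 0 x; have [?|?] := leP 0 y; lra.
Qed.

Lemma clamp_lipschitz x y : x <= y -> clamp y - clamp x <= y - x.
Proof.
move=> xy; rewrite /clamp.
by have [?|?] := leP 1 x; have [?|?] := leP 1 y; rewrite ?(max_r ler01);
  have [?|?] := leP 0 x; have [?|?] := leP 0 y; lra.
Qed.

(** Transfers properties proved in the first argument to the second. *)
Lemma is_copula_swap (C : R -> R -> R) :
  is_copula C -> is_copula (fun u v => C v u).
Proof.
case=> C0 C1 C2; split.
- by move=> u /C0[].
- by move=> u /C1[].
- by move=> u1 u2 v1 v2 ? ? ? ? ? ?; have := C2 v1 v2 u1 u2; lra.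
Qed.

Variables (C : R -> R -> R).
Hypothesis copC : is_copula C.

(** The rectangle inequality on [x, y] x [0, v], whose lower side contributes 0. *)
Lemma copula_homo v x y : 0 <= v <= 1 -> 0 <= x -> x <= y -> y <= 1 ->
  C x v <= C y v.
Proof.
case: copC => C0 _ C2 /andP[v0 v1] x0 xy y1.
have := C2 x y 0 v x0 xy y1 (lexx _) v0 v1.
have [] := C0 x _; first by apply/andP; split; lra.
have [] := C0 y _; first by apply/andP; split; lra.
lra.
Qed.

(** The rectangle inequality on [x, y] x [v, 1], whose upper side contributes [y - x]. *)
Lemma copula_lipschitz v x y : 0 <= v <= 1 -> 0 <= x -> x <= y -> y <= 1 ->
  C y v - C x v <= y - x.
Proof.
case: copC => _ C1 C2 /andP[v0 v1] x0 xy y1.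
have := C2 x y v 1 x0 xy y1 v0 v1 (lexx _).
have [] := C1 x _; first by apply/andP; split; lra.
have [] := C1 y _; first by apply/andP; split; lra.
lra.
Qed.

Lemma copula_clamp_homo v : 0 <= v <= 1 ->
  {homo (fun x => C (clamp x) v) : x y / x <= y}.
Proof.
move=> v01 x y xy; have /andP[? ?] := clamp01 x; have /andP[? ?] := clamp01 y.
by apply: copula_homo => //; exact: clamp_homo.
Qed.

Lemma copula_clamp_lipschitz v : 0 <= v <= 1 ->
  forall x y, x <= y -> C (clamp y) v - C (clamp x) v <= y - x.
Proof.
move=> v01 x y xy; have /andP[? ?] := clamp01 x; have /andP[? ?] := clamp01 y.
by apply: le_trans (clamp_lipschitz xy); apply: copula_lipschitz => //; exact: clamp_homo.
Qed.

Lemma copula_clamp_continuous v : 0 <= v <= 1 ->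
  continuous (fun x => C (clamp x) v).
Proof.
move=> v01; apply: monotone_lipschitz_continuous.
  exact: copula_clamp_homo.
exact: copula_clamp_lipschitz.
Qed.

(** Approximates [partial1 C] by functions continuous in [u] for [v] in [0, 1], and in [v] once [v]
    is clamped. *)
Definition quotient1 (n : nat) (u v : R) : R :=
  n.+1%:R * (C (clamp (u + n.+1%:R^-1)) v - C (clamp u) v).

Lemma quotient1_01 n u v : 0 <= v <= 1 -> 0 <= quotient1 n u v <= 1.
Proof.
move=> v01; have un : u <= u + n.+1%:R^-1 by rewrite lerDl.
apply/andP; split.
  by rewrite mulr_ge0// subr_ge0 copula_clamp_homo.
rewrite /quotient1 (le_trans (ler_wpM2l _ (copula_clamp_lipschitz v01 un)))//.
by rewrite addrAC subrr add0r divff.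
Qed.

(** Comes from the clamped section. The measurable bounded [k] then stands in for [partial1 C], and
    the last clause ties it to the quotients. *)
Lemma copula_density v : 0 <= v <= 1 -> exists k : R -> R,
  [/\ measurable_fun [set: R] k, (forall x, 0 <= k x <= 1),
      (forall u, 0 <= u <= 1 ->
         (\int[mu]_(t in `[0%R, u]) (k t)%:E = (C u v)%:E)%E),
      (\int[mu]_(u in `[0%R, 1%R]) ((partial1 C u v) ^+ 2)%:E =
       \int[mu]_(u in `[0%R, 1%R]) ((k u) ^+ 2)%:E)%E &
      {ae mu, forall u : R, 0 < u < 1 -> quotient1 n u v @[n --> \oo] --> k u}].
Proof.
move=> v01.
have [k [mk k01 kE dk]] := monotone_lipschitz_density (copula_clamp_homo v01)
  (copula_clamp_lipschitz v01).
have Cu0 : C 0 v = 0 by case: copC => /(_ v v01)[].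
exists k; split => //.
- move=> u u01; rewrite kE// !clamp_id ?Cu0 ?subr0//.
  by rewrite lexx ler01.
- have : {ae mu, forall x : R, 0 <= x <= 1 -> partial1 C x v = k x}.
    apply: lebesgue_ae_cc01; apply: lebesgue_aeS dk => x H x01; have dx := H x01.
    rewrite /partial1 derive1E -(@derive_val _ _ _ _ _ _ _ dx).
    (* Around an interior point [clamp] is the identity, so both functions have the same
       derivative. *)
    move/andP: x01 => [x_gt0 x_lt1]; apply: near_eq_derive; near=> y.
    rewrite clamp_id//; apply/andP; split; near: y.
      exact: lt_le_nbhsr x_gt0.
    exact: lt_le_nbhsl x_lt1.
  case=> N [mN N0 HN].
  apply: (@ge0_ae_eq_integral_nonmeasurable _ _ _ _ _ N) => //.
  + by apply/measurable_EFinP/measurable_funTS; exact: measurable_funX.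
  + by move=> x _; rewrite lee_fin sqr_ge0.
  + by move=> x _; rewrite lee_fin sqr_ge0.
  move=> x /=; rewrite in_itv/= => x01 Nx; congr (_ ^+ 2)%:E.
  by apply: contrapT => dx; apply: Nx; apply: HN => /= /(_ x01).
- by apply: lebesgue_aeS dk => u H /H /is_derive_cvg_quotient.
Unshelve. all: by end_near. Qed.

End copula_density.

(** * Measurability of the inner integral of xi *)

Section energy.
Context {R : realType}.
Notation mu := (@lebesgue_measure R).
Notation I01 := (`[0%R, 1%R]%classic : set (measurableTypeR R)).

Lemma bounded_integrable_itv (a b M : R) (f : R -> R) :
  measurable_fun (`[a, b] : set R) f ->
  (forall x, a <= x <= b -> `|f x| <= M) ->
  mu.-integrable `[a, b] (EFin \o f).
Proof.
move=> mf fM; apply: measurable_bounded_integrable => //.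
- by rewrite /= lebesgue_measure_itv/=; case: ifP => // _; rewrite -EFinB ltry.
- exists M; split; first exact: num_real.
  move=> x Mx y /=; rewrite in_itv/= => aby.
  exact: le_trans (fM y aby) (ltW Mx).
Qed.

Variable C : R -> R -> R.
Hypothesis copC : is_copula C.

Definition energy (v : R) : \bar R :=
  (\int[mu]_(u in `[0%R, 1%R]) ((partial1 C u v) ^+ 2)%:E)%E.

Let energy_approx n v : R :=
  \int[mu]_(u in `[0%R, 1%R]) (quotient1 C n u (clamp v)) ^+ 2.

Let quotient1_sqr_bound n u v : 0 <= v <= 1 -> `|quotient1 C n u v ^+ 2| <= 1.
Proof.
move=> v01; have /andP[q0 q1] := quotient1_01 copC n u v01.
by rewrite ger0_norm ?sqr_ge0// exprn_ile1.
Qed.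

Let measurable_quotient1 n v : 0 <= v <= 1 ->
  measurable_fun [set: R] (fun u => quotient1 C n u v ^+ 2).
Proof.
move=> v01; apply: measurable_funX; apply: measurable_funM.
  exact: measurable_cst.
apply: continuous_measurable_fun => x.
have cC := copula_clamp_continuous copC v01.
apply: cvgB; last exact: cC.
apply: (@cvg_comp _ _ _ (fun x => x + n.+1%:R^-1) (fun x => C (clamp x) v)).
  by apply: cvgD; [exact: cvg_id|exact: cvg_cst].
exact: cC.
Qed.

(** The squared quotients are bounded by 1 and continuous in [v], so continuity passes under the
    integral. *)
Let continuous_energy_approx n : continuous (energy_approx n).
Proof.
move=> v0.
have := @continuity_under_integral R _ _ mu
  (fun v u => quotient1 C n u (clamp v) ^+ 2) _ (measurable_cc 0 1) (v0 - 1) (v0 + 1).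
move=> /(_ _ _ (cst 1)); apply.
- move=> v _; apply: (@bounded_integrable_itv _ _ 1).
    by apply: measurable_funTS; apply: measurable_quotient1; exact: clamp01.
  by move=> u _; apply: quotient1_sqr_bound; exact: clamp01.
- apply: aeW => u _ v _.
  have cC y := copula_clamp_continuous (is_copula_swap copC) (clamp01 y).
  have cq : continuous (fun v => quotient1 C n u (clamp v)).
    move=> w; apply: cvgM; first exact: cvg_cst.
    by apply: cvgB; exact: cC.
  by rewrite /continuous_at expr2; apply: cvgM; exact: cq.
- apply: (@bounded_integrable_itv _ _ 1); first exact: measurable_cst.
  by move=> u _; rewrite /= normr1.
- move=> v _; apply: aeW => u _; apply: quotient1_sqr_bound; exact: clamp01.
- by rewrite inE/= in_itv/=; apply/andP; split; lra.
Qed.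

Let energy_approx_cvg v : 0 <= v <= 1 ->
  (energy_approx n v)%:E @[n --> \oo] --> energy v.
Proof.
move=> v01.
have [k [mk k01 _ kA dk]] := copula_density copC v01.
rewrite /energy kA.
have H := @dominated_convergence _ _ R mu I01 (measurable_cc 0 1)
  (fun n u => (quotient1 C n u v ^+ 2)%:E) (fun u => (k u ^+ 2)%:E) (cst 1%E).
have [||||| _ _ +] := H.
- move=> n; apply/measurable_EFinP/measurable_funTS; exact: measurable_quotient1.
- by apply/measurable_EFinP/measurable_funTS; exact: measurable_funX.
- apply: lebesgue_aeS (lebesgue_ae_cc01 dk) => u Hu /=; rewrite in_itv/= => /Hu qk.
  apply: cvg_EFin; first exact: nearW.
  have -> : fine \o (fun n => (quotient1 C n u v ^+ 2)%:E) =
    (fun n => quotient1 C n u v * quotient1 C n u v).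
    by apply/funext => n /=; rewrite expr2.
  by rewrite expr2; apply: cvgM.
- apply: (@bounded_integrable_itv _ _ 1 (cst 1)); first exact: measurable_cst.
  by move=> u _; rewrite /= normr1.
- by apply: aeW => u n _; rewrite lee_fin; exact: quotient1_sqr_bound.
apply: cvg_trans; apply: near_eq_cvg; near=> n.
rewrite /energy_approx /Rintegral fineK clamp_id//.
apply: integrable_fin_num => //.
apply: (@bounded_integrable_itv _ _ 1).
  by apply: measurable_funTS; exact: measurable_quotient1.
by move=> u _; exact: quotient1_sqr_bound.
Unshelve. all: by end_near. Qed.

(** A pointwise limit of the continuous [energy_approx n], by dominated convergence of the
    quotients. *)
Lemma measurable_energy : measurable_fun I01 energy.
Proof.
apply: (emeasurable_fun_cvg (fun n v => (energy_approx n v)%:E)).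
  move=> n; apply/measurable_EFinP/measurable_funTS.
  by apply: continuous_measurable_fun; exact: continuous_energy_approx.
by move=> v /=; rewrite in_itv/=; exact: energy_approx_cvg.
Qed.

End energy.

(** * Calculus of integrals over [0, b] *)

Section has_integral.
Context {R : realType}.
Notation mu := (@lebesgue_measure R).
Implicit Types (f g : R -> R) (b c l m v : R).

(** Integrability and value travel together, so the integral of a linear combination is read off
    from its terms. *)
Definition has_integral b f l : Prop :=
  mu.-integrable `[0%R, b] (EFin \o f) /\ \int[mu]_(x in `[0%R, b]) f x = l.

Lemma has_integralE b f l : has_integral b f l ->
  (\int[mu]_(x in `[0%R, b]) (f x)%:E = l%:E)%E.
Proof.
move=> [fint <-]; rewrite /Rintegral fineK//.
exact: integrable_fin_num fint.
Qed.

Lemma has_integralZD b c f g l m : has_integral b f l -> has_integral b g m ->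
  has_integral b (fun x => c * f x + g x) (c * l + m).
Proof.
move=> [fint <-] [gint <-].
have cfint : mu.-integrable `[0%R, b] (EFin \o (fun x => c * f x)).
  exact: (integrableZl (measurable_cc _ _) c fint).
split; first exact: (integrableD (measurable_cc _ _) cfint gint).
by rewrite RintegralD// RintegralZl.
Qed.

Lemma has_integralZ b c f l : has_integral b f l ->
  has_integral b (fun x => c * f x) (c * l).
Proof.
move=> [fint <-]; split; first exact: (integrableZl (measurable_cc _ _) c fint).
by rewrite RintegralZl.
Qed.

Lemma eq_has_integral b f g l : (forall x, 0 <= x <= b -> f x = g x) ->
  has_integral b f l -> has_integral b g l.
Proof.
move=> fg [fint <-]; split.
  apply: eq_integrable fint => // x; rewrite inE/= in_itv/= => xb.
  by rewrite /= fg.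
by apply: eq_Rintegral => x; rewrite inE/= in_itv/= => xb; rewrite fg.
Qed.

Lemma has_integral_bounded b f (M : R) :
  measurable_fun (`[0, b] : set R) f ->
  (forall x, 0 <= x <= b -> `|f x| <= M) ->
  has_integral b f (\int[mu]_(x in `[0%R, b]) f x).
Proof. by move=> mf fM; split => //; exact: bounded_integrable_itv mf fM. Qed.

Lemma lebesgue_measure_cc0 b : 0 <= b -> mu `[0%R, b] = b%:E.
Proof.
move=> b0; rewrite lebesgue_measure_itv/= lte_fin.
have [_|b0'] := ltP 0 b; first by rewrite -EFinB subr0.
by congr EFin; apply/eqP; rewrite eq_le b0 b0'.
Qed.

Lemma has_integral_cst b c : 0 <= b -> has_integral b (cst c) (c * b).
Proof.
move=> b0; split; last by rewrite Rintegral_cst//= lebesgue_measure_cc0.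
by apply: (@bounded_integrable_itv _ _ _ `|c|) => //; exact: measurable_cst.
Qed.

(** Serves to evaluate the cross term [\int s_v k_v] as [C v v]. *)
Lemma has_integral_restrict b f v : 0 <= v <= b ->
  mu.-integrable `[0%R, b] (EFin \o f) ->
  has_integral b (fun x => \1_(`[0, v]) x * f x) (\int[mu]_(x in `[0%R, v]) f x).
Proof.
move=> /andP[v0 vb] fint.
have E x : (\1_(`[0%R, v]) x * f x)%:E = ((EFin \o f) \_ `[0%R, v]) x.
  rewrite patchE indicE; case: (x \in _) => /=; first by rewrite mul1r.
  by rewrite mul0r.
have I : `[0%R, b] `&` `[0%R, v] = `[0%R, v]%classic :> set R.
  apply/seteqP; split => x /=; rewrite !in_itv/=; first by case.
  by move=> /andP[-> xv]; split; rewrite //= (le_trans xv).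
split.
  have : mu.-integrable `[0%R, b] ((EFin \o f) \_ `[0%R, v]).
    apply/(integrable_restrict _ (measurable_cc _ _) (measurable_cc _ _)).
    rewrite I; apply: integrableS fint => // x /=.
    by rewrite !in_itv/= => /andP[-> xv] /=; exact: le_trans xv vb.
  by apply: eq_integrable => // x _; rewrite -E.
rewrite /Rintegral; congr fine; rewrite -[in RHS]I integral_mkcondr.
by apply: eq_integral => x _; rewrite E.
Qed.

(** Used with [b = 1], giving [v], and with [b = u], giving the term [min u v] of the Frechet
    copula. *)
Lemma has_integral_step b v : 0 <= b -> 0 <= v ->
  has_integral b (\1_(`[0, v])) (Num.min b v).
Proof.
move=> b0 v0; split.
  apply: (@bounded_integrable_itv _ _ _ 1) => //.
  by move=> x _; rewrite indicE; case: (x \in _); rewrite ?normr1 ?normr0.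
rewrite /Rintegral integral_indic//=.
rewrite (_ : _ `&` _ = `[0%R, Num.min b v]%classic); last first.
  apply/seteqP; split => x /=; rewrite !in_itv/= le_min.
    by move=> [/andP[-> ->] /andP[_ ->]].
  by move=> /andP[-> /andP[-> ->]].
by rewrite lebesgue_measure_cc0// le_min b0 v0.
Qed.

Lemma has_integral_exprn n : has_integral 1 (fun x => x ^+ n) (n.+1%:R^-1).
Proof.
have cX (m : nat) : continuous (fun x : R => x ^+ m) by exact: exprn_continuous.
split.
  apply: (@bounded_integrable_itv _ _ _ 1).
    by apply: measurable_funTS; exact: measurable_funX.
  by move=> x /andP[x0 x1]; rewrite ger0_norm ?exprn_ge0// exprn_ile1.
rewrite /Rintegral (@continuous_FTC2 _ _ (fun x => n.+1%:R^-1 * x ^+ n.+1))//=.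
- by rewrite expr1n expr0n/= mulr1 mulr0 subr0.
- by apply: continuous_subspaceT; exact: cX.
- have cF : continuous (fun x : R => n.+1%:R^-1 * x ^+ n.+1).
    by move=> x; apply: cvgM; [exact: cvg_cst|exact: cX].
  split.
  + by move=> x _; apply: derivableM => //; exact: exprn_derivable.
  + exact/cvg_at_right_filter/cF.
  + exact/cvg_at_left_filter/cF.
- move=> x _; rewrite derive1E deriveM//; last exact: exprn_derivable.
  rewrite derive_cst exp_derive /GRing.scale/= mulr0 addr0 mulr1.
  by rewrite mulrA mulVf// mul1r.
Qed.

End has_integral.

(** * The defect, its zeros and its integral over v *)

Section defect.
Context {R : realType}.
Notation mu := (@lebesgue_measure R).
Variable C : R -> R -> R.
Hypothesis copC : is_copula C.

(* The squared L2 distance between the density of C(., v) and that of the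
   Frechet copula, see [has_integral_defect]. *)
Definition defect (a v : R) : R :=
  fine (energy C v) - v ^+ 2 - 2 * a * (C v v - v ^+ 2) + a ^+ 2 * (v - v ^+ 2).

Lemma energy01 v : 0 <= v <= 1 ->
  energy C v \is a fin_num /\ 0 <= fine (energy C v) <= 1.
Proof.
move=> v01; have [k [mk k01 _ kA _]] := copula_density copC v01.
have k2 x : 0 <= k x ^+ 2 <= 1.
  by have /andP[? ?] := k01 x; rewrite sqr_ge0 exprn_ile1.
have ki : has_integral 1 (fun u => k u ^+ 2) (fine (energy C v)).
  rewrite /energy kA; apply: (@has_integral_bounded _ _ _ 1).
    by apply: measurable_funTS; exact: measurable_funX.
  by move=> x _; have /andP[? ?] := k2 x; rewrite ger0_norm.
have E := has_integralE ki.
split; first by rewrite /energy kA E.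
apply/andP; split.
  apply: fine_ge0; apply: integral_ge0 => x _; by rewrite lee_fin sqr_ge0.
have := has_integral_cst 1 (@ler01 R); rewrite mulr1 => /has_integralE E1.
rewrite -lee_fin -E -E1; apply: ge0_le_integral => //=.
- by move=> x _; rewrite lee_fin sqr_ge0.
- by apply/measurable_EFinP/measurable_funTS; exact: measurable_funX.
- by move=> x _; rewrite lee_fin; have /andP[] := k2 x.
Qed.

(** [k] minus the density [(1 - a) v + a s_v] of the Frechet section, with [s_v] the indicator of
    [0, v]. *)
Definition residual (k : R -> R) (a v u : R) : R := k u - v - a * (\1_(`[0, v]) u - v).

Lemma measurable_residual (k : R -> R) (a v : R) : measurable_fun [set: R] k ->
  measurable_fun [set: R] (residual k a v).
Proof.
move=> mk; apply: measurable_funB.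
  by apply: measurable_funB => //; exact: measurable_cst.
apply: measurable_funM; first exact: measurable_cst.
by apply: measurable_funB; [exact: measurable_indic|exact: measurable_cst].
Qed.

(** Expand the square: [k] integrates to [C 1 v = v], [s_v k] to [C v v], and [s_v^2 = s_v] to
    [v]. *)
Lemma has_integral_defect (k : R -> R) (a v : R) : 0 <= v <= 1 ->
  measurable_fun [set: R] k -> (forall x, 0 <= k x <= 1) ->
  (forall u, 0 <= u <= 1 ->
    (\int[mu]_(t in `[0%R, u]) (k t)%:E = (C u v)%:E)%E) ->
  (energy C v = \int[mu]_(u in `[0%R, 1%R]) ((k u) ^+ 2)%:E)%E ->
  has_integral 1 (fun u => residual k a v u ^+ 2) (defect a v).
Proof.
move=> v01 mk k01 kE kA; have /andP[v0 v1] := v01.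
have k2 : has_integral 1 (fun u => k u ^+ 2) (fine (energy C v)).
  rewrite kA; apply: (@has_integral_bounded _ _ _ 1).
    by apply: measurable_funTS; exact: measurable_funX.
  move=> x _; have /andP[? ?] := k01 x.
  by rewrite ger0_norm ?sqr_ge0// exprn_ile1.
have kint : mu.-integrable `[0%R, 1%R] (EFin \o k).
  apply: (@bounded_integrable_itv _ _ _ 1); first exact: measurable_funTS.
  by move=> x _; have /andP[? ?] := k01 x; rewrite ger0_norm.
have k1 : has_integral 1 k v.
  split => //; rewrite /Rintegral kE ?ler01 ?lexx//=.
  by case: copC => _ /(_ v v01)[].
have ks := has_integral_restrict v01 kint.
have {}ks : has_integral 1 (fun u => \1_(`[0, v]) u * k u) (C v v).
  by move: ks; rewrite /Rintegral kE.
have s1 := has_integral_step (@ler01 R) v0; rewrite min_r// in s1.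
(* The constant part of the residual, which reads [k - a s_v - c]. *)
pose c := v - a * v.
have c1 := has_integral_cst (c ^+ 2) (@ler01 R).
have := has_integralZD 1 k2 (has_integralZD (- (2 * c)) k1
  (has_integralZD (- (2 * a)) ks (has_integralZD (2 * a * c + a ^+ 2) s1 c1))).
rewrite [X in has_integral _ _ X](_ : _ = defect a v); last by rewrite /defect /c; ring.
apply: eq_has_integral => u _; rewrite /residual /c indicE.
by case: (u \in _) => /=; ring.
Qed.

Lemma defect_ge0 a v : 0 <= v <= 1 -> 0 <= defect a v.
Proof.
move=> v01; have [k [mk k01 kE kA _]] := copula_density copC v01.
have [_ <-] := has_integral_defect a v01 mk k01 kE kA.
by apply: fine_ge0; apply: integral_ge0 => u _; rewrite lee_fin sqr_ge0.
Qed.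

(** A square with zero integral vanishes a.e., which determines [k] a.e.; integrating [k] over
    [0, u] recovers [C u v]. *)
Lemma defect_eq0 a v : 0 <= v <= 1 -> defect a v = 0 ->
  forall u, 0 <= u <= 1 -> C u v = frechet a u v.
Proof.
move=> v01 d0 u u01; have [k [mk k01 kE kA _]] := copula_density copC v01.
have /andP[v0 v1] := v01; have /andP[u0 u1] := u01.
have := has_integralE (has_integral_defect a v01 mk k01 kE kA); rewrite d0 => r0.
have mr2 : measurable_fun [set: R] (fun u => residual k a v u ^+ 2).
  by apply: measurable_funX; exact: measurable_residual.
have rae : {ae mu, forall t : R, 0 <= t <= 1 ->
    k t = v - a * v + a * \1_(`[0, v]) t}.
  have mr : measurable_fun (`[0%R, 1%R] : set (measurableTypeR R))
      (fun u => (residual k a v u ^+ 2)%:E).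
    by apply/measurable_EFinP; exact: measurable_funTS.
  have r_ae : ae_eq mu (`[0%R, 1%R]%classic : set (measurableTypeR R))
      (fun u => (residual k a v u ^+ 2)%:E) (cst 0%E).
    apply/(ae_eq_integral_abs mu (measurable_cc 0 1) mr).
    rewrite -[RHS]r0; apply: eq_integral => x _.
    by rewrite gee0_abs// lee_fin sqr_ge0.
  apply: lebesgue_aeS r_ae => t H t01.
  have /eqP : (residual k a v t ^+ 2)%:E = 0%E by apply: H; rewrite /= in_itv.
  by rewrite /cst/= eqe sqrf_eq0 /residual => /eqP; lra.
have s1 := has_integral_step u0 v0.
have c1 := has_integral_cst (v - a * v) u0.
have /has_integralE := has_integralZD a s1 c1.
rewrite (_ : a * _ + _ = frechet a u v); last by rewrite /frechet; ring.
move=> fE; apply: EFin_inj; rewrite -kE// -fE; apply: ae_eq_integral.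
- exact: measurable_cc.
- by apply/measurable_EFinP/measurable_funTS.
- apply/measurable_EFinP/measurable_funTS; apply: measurable_funD;
    last exact: measurable_cst.
  by apply: measurable_funM; [exact: measurable_cst|exact: measurable_indic].
apply: lebesgue_aeS rae => t H /=; rewrite in_itv/= => /andP[t0 tu].
by rewrite H ?t0 ?(le_trans tu)// addrC.
Qed.

Lemma has_integral_energy : has_integral 1 (fun v => fine (energy C v))
  ((chatterjee_xi C + 2) / 6).
Proof.
have E : \int[mu]_(x in `[0%R, 1%R]) fine (energy C x) = (chatterjee_xi C + 2) / 6.
  rewrite /chatterjee_xi subrK [6 * _]mulrC mulfK ?pnatr_eq0//.
  rewrite /Rintegral; congr fine; apply: eq_integral => v.
  by rewrite inE/= in_itv/= => /energy01[? _]; rewrite fineK.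
rewrite -E; apply: (@has_integral_bounded _ _ _ 1); last first.
  by move=> v /energy01[_ /andP[? ?]]; rewrite ger0_norm.
apply: measurableT_comp; first exact: fine_measurable.
exact: measurable_energy.
Qed.

Lemma has_integral_diagonal : has_integral 1 (fun v => C v v)
  ((footrule_psi C + 2) / 6).
Proof.
have E : \int[mu]_(x in `[0%R, 1%R]) (C x x) = (footrule_psi C + 2) / 6.
  by rewrite /footrule_psi subrK [6 * _]mulrC mulfK ?pnatr_eq0.
(* Monotonicity in each argument makes the clamped diagonal nondecreasing, hence measurable. *)
pose d v := C (clamp v) (clamp v).
have dnd : {homo d : x y / x <= y}.
  move=> x y xy; apply: (@le_trans _ _ (C (clamp y) (clamp x))).
    by apply: copula_clamp_homo => //; exact: clamp01.
  exact: (copula_clamp_homo (is_copula_swap copC) (clamp01 y)).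
have dC x : 0 <= x <= 1 -> d x = C x x by move=> x01; rewrite /d clamp_id.
apply: (eq_has_integral dC).
have <- : \int[mu]_(x in `[0%R, 1%R]) (d x) = (footrule_psi C + 2) / 6.
  by rewrite -E; apply: eq_Rintegral => x; rewrite inE/= in_itv/= => /dC.
apply: (@has_integral_bounded _ _ _ 1).
  exact: nondecreasing_measurable.
have [C0 C1 _] := copC.
move=> x x01; have /andP[x0 x1] := x01; rewrite dC// ger0_norm.
  apply: (@le_trans _ _ (C 1 x)); first exact: copula_homo.
  by have [_ ->] := C1 x x01.
apply: (@le_trans _ _ (C 0 x)); last exact: copula_homo.
by have [_ ->] := C0 x x01.
Qed.

Lemma has_integral_integrated_defect a : has_integral 1 (defect a)
  ((chatterjee_xi C - 2 * a * footrule_psi C + a ^+ 2) / 6).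
Proof.
(* The last two terms collect the powers [v^2] and [v] of the defect, with integrals 1/3 and 1/2. *)
have := has_integralZD 1 has_integral_energy
  (has_integralZD (- (2 * a)) has_integral_diagonal
  (has_integralZD (2 * a - 1 - a ^+ 2) (@has_integral_exprn R 2)
  (has_integralZ (a ^+ 2) (@has_integral_exprn R 1)))).
rewrite [X in has_integral _ _ X](_ : _ =
  (chatterjee_xi C - 2 * a * footrule_psi C + a ^+ 2) / 6).
  by apply: eq_has_integral => v _; rewrite /defect expr1; ring.
by field.
Qed.

End defect.

(** * The Frechet family and its values of xi and psi *)

Section frechet.
Context {R : realType}.
Notation mu := (@lebesgue_measure R).
Variable a : R.
Hypothesis a01 : 0 <= a <= 1.

Lemma min_supermodular (u1 u2 v1 v2 : R) : u1 <= u2 -> v1 <= v2 ->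
  0 <= Num.min u1 v1 - Num.min u1 v2 - Num.min u2 v1 + Num.min u2 v2.
Proof.
move=> u12 v12; have [?|?] := leP u1 v1; have [?|?] := leP u1 v2;
  have [?|?] := leP u2 v1; have [?|?] := leP u2 v2; lra.
Qed.

Lemma is_copula_frechet : is_copula (frechet a).
Proof.
have /andP[a0 a1] := a01; split.
- by move=> u /andP[u0 u1]; rewrite /frechet (min_r u0) (min_l u0); split; ring.
- by move=> u /andP[u0 u1]; rewrite /frechet (min_l u1) (min_r u1); split; ring.
- move=> u1 u2 v1 v2 _ u12 _ _ v12 _.
  (* The mass of a rectangle is the convex combination of its masses under the product and the
     minimum. *)
  have -> : frechet a u1 v1 - frechet a u1 v2 - frechet a u2 v1 + frechet a u2 v2 =
    (1 - a) * ((u2 - u1) * (v2 - v1)) +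
    a * (Num.min u1 v1 - Num.min u1 v2 - Num.min u2 v1 + Num.min u2 v2).
    by rewrite /frechet; ring.
  by rewrite addr_ge0 ?mulr_ge0 ?subr_ge0// min_supermodular.
Qed.

(** Off the kink at [u = v] the section is locally affine, with slope [(1 - a) v + a] before [v] and
    [(1 - a) v] after it. *)
Lemma partial1_frechet (u v : R) : 0 <= u -> u != v ->
  partial1 (frechet a) u v = (1 - a) * v + a * \1_(`[0, v]) u.
Proof.
move=> u0 uv.
have affine (p q : R) : derive1 (fun t : R => p * t + q) u = p.
  rewrite derive1E deriveD ?derive_cst ?addr0//.
  by rewrite deriveM// derive_cst scaler0 addr0 derive_id /GRing.scale/= mulr1.
rewrite /partial1 indicE; have [uv'|vu] := ltP u v.
  rewrite mem_set/= ?in_itv/= ?u0 ?ltW// mulr1.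
  rewrite -[RHS](affine _ 0) !derive1E; apply: near_eq_derive; near=> t.
  rewrite /frechet min_l; first by ring.
  by near: t; exact: lt_le_nbhsl.
have vu' : v < u by rewrite lt_neqAle eq_sym uv.
rewrite memNset ?mulr0 ?addr0; last first.
  by rewrite /= in_itv/= => /andP[_]; rewrite leNgt vu'.
rewrite -[RHS](affine _ (a * v)) !derive1E; apply: near_eq_derive; near=> t.
rewrite /frechet min_r; first by ring.
by near: t; exact: lt_le_nbhsr.
Unshelve. all: by end_near. Qed.

Lemma energy_frechet (v : R) : 0 <= v <= 1 ->
  energy (frechet a) v = (v ^+ 2 + a ^+ 2 * (v - v ^+ 2))%:E.
Proof.
move=> /andP[v0 v1]; pose k u : R := (1 - a) * v + a * \1_(`[0, v]) u.
have mk : measurable_fun [set: R] k.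
  apply: measurable_funD; first exact: measurable_cst.
  by apply: measurable_funM; [exact: measurable_cst|exact: measurable_indic].
transitivity (\int[mu]_(u in `[0%R, 1%R]) (k u ^+ 2)%:E)%E.
  (* The kink is the only exceptional point. *)
  apply: (@ge0_ae_eq_integral_nonmeasurable _ (measurableTypeR R) R mu _ [set v]).
  - exact: measurable_cc.
  - exact: (measurable_set1 v).
  - exact: lebesgue_measure_set1.
  - by apply/measurable_EFinP/measurable_funTS; exact: measurable_funX.
  - by move=> x _; rewrite lee_fin sqr_ge0.
  - by move=> x _; rewrite lee_fin sqr_ge0.
  move=> u /=; rewrite in_itv/= => /andP[u0 u1] /eqP uv.
  by rewrite partial1_frechet.
have s1 := has_integral_step (@ler01 R) v0; rewrite min_r// in s1.
have c1 := has_integral_cst (((1 - a) * v) ^+ 2) (@ler01 R).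
have := has_integralZD (2 * a * (1 - a) * v + a ^+ 2) s1 c1.
rewrite [X in has_integral _ _ X](_ : _ = v ^+ 2 + a ^+ 2 * (v - v ^+ 2)); last by ring.
move=> H; apply: has_integralE; apply: eq_has_integral H => u _.
by rewrite /k indicE /cst/=; case: (u \in _) => /=; ring.
Qed.

(** The energy [(1 - a^2) v^2 + a^2 v] has integral [(a^2 + 2) / 6]. *)
Lemma chatterjee_xi_frechet : chatterjee_xi (frechet a) = a ^+ 2.
Proof.
have [_ E] := has_integral_energy is_copula_frechet.
have H := has_integralZD (1 - a ^+ 2) (@has_integral_exprn R 2)
  (has_integralZ (a ^+ 2) (@has_integral_exprn R 1)).
have := eq_has_integral _ H => /(_ (fun v => fine (energy (frechet a) v)))[].
  by move=> v v01; rewrite energy_frechet//=; ring.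
by move=> _; rewrite E => E'; lra.
Qed.

Lemma footrule_psi_frechet : footrule_psi (frechet a) = a.
Proof.
have [_ E] := has_integral_diagonal is_copula_frechet.
have H := has_integralZD (1 - a) (@has_integral_exprn R 2)
  (has_integralZ a (@has_integral_exprn R 1)).
have := eq_has_integral _ H => /(_ (fun v => frechet a v v))[].
  by move=> v v01; rewrite /frechet minxx; ring.
by move=> _; rewrite E => E'; lra.
Qed.

End frechet.

(** * The upper bound and the case of equality *)

Section bound.
Context {R : realType}.
Notation mu := (@lebesgue_measure R).

(** An interval of positive length cannot lie in a null set. This is what extends an identity from
    a.e. [v] to every [v]. *)
Lemma ae_dense01 (P : R -> Prop) (v e : R) :
  {ae mu, forall x : R, 0 <= x <= 1 -> P x} -> 0 <= v <= 1 -> 0 < e ->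
  exists w, [/\ 0 <= w <= 1, `|v - w| <= e & P w].
Proof.
move=> [N [mN N0 HN]] /andP[v0 v1] e0; apply: contrapT => H.
pose l := Num.max 0 (v - e); pose r := Num.min 1 (v + e).
have lr : l < r.
  by rewrite /l /r gt_max !lt_min; apply/andP; split; apply/andP; split; lra.
have : (mu `[l, r] <= mu N)%E.
  apply: le_measure; rewrite ?inE//.
  move=> x /=; rewrite in_itv/= /l /r ge_max le_min.
  move=> /andP[/andP[x0 xl] /andP[x1 xr]]; apply: HN => /= Px; apply: H.
  exists x; split; [by rewrite x0 x1|by rewrite ler_distl; apply/andP; split; lra|].
  by apply: Px; rewrite x0 x1.
by rewrite N0 lebesgue_measure_itv/= lte_fin lr -EFinB lee_fin subr_le0 leNgt lr.
Qed.

Lemma copula_dist (C : R -> R -> R) (u v w : R) : is_copula C ->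
  0 <= u <= 1 -> 0 <= v <= 1 -> 0 <= w <= 1 -> `|C u v - C u w| <= `|v - w|.
Proof.
move=> /is_copula_swap copC u01 /andP[v0 v1] /andP[w0 w1].
have [vw|/ltW wv] := leP v w.
  have := copula_homo copC u01 v0 vw w1; have := copula_lipschitz copC u01 v0 vw w1.
  by move=> /= ? ?; rewrite !ler0_norm ?subr_le0//; lra.
have := copula_homo copC u01 w0 wv v1; have := copula_lipschitz copC u01 w0 wv v1.
by move=> /= ? ?; rewrite !ger0_norm ?subr_ge0.
Qed.

Variable C : R -> R -> R.
Hypothesis copC : is_copula C.

Lemma footrule_psi_le_sqrt_xi : footrule_psi C <= Num.sqrt (chatterjee_xi C).
Proof.
(* psi may be negative, so it is bounded through [|psi| = sqrt (psi^2)]. *)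
apply: le_trans (ler_norm _) _; rewrite -sqrtr_sqr ler_wsqrtr//.
(* The integrated defect is quadratic in [a] with minimum at [a = psi], of value
   [(xi - psi^2) / 6]. *)
have [_ E] := has_integral_integrated_defect copC (footrule_psi C).
have : 0 <= \int[mu]_(x in `[0%R, 1%R]) defect C (footrule_psi C) x.
  apply: fine_ge0; apply: integral_ge0 => v /=; rewrite in_itv/= => v01.
  by rewrite lee_fin defect_ge0.
by rewrite E; lra.
Qed.

Lemma footrule_psi_sqrt_xi_unique (a : R) : 0 <= a <= 1 ->
  chatterjee_xi C = a ^+ 2 -> footrule_psi C = a ->
  forall u v, 0 <= u <= 1 -> 0 <= v <= 1 -> C u v = frechet a u v.
Proof.
move=> a01 xiE psiE u v u01 v01.
have dint := has_integral_integrated_defect copC a.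
(* Here the integrated defect is [(a^2 - 2 a^2 + a^2) / 6]. *)
rewrite xiE psiE [X in has_integral _ _ X](_ : _ = 0) in dint; last by ring.
have md : measurable_fun (`[0%R, 1%R] : set (measurableTypeR R)) (EFin \o defect C a).
  by have [/measurable_int] := dint.
have dae : ae_eq mu (`[0%R, 1%R]%classic : set (measurableTypeR R))
    (EFin \o defect C a) (cst 0%E).
  apply/(ae_eq_integral_abs mu (measurable_cc 0 1) md).
  rewrite -[RHS](has_integralE dint); apply: eq_integral => x.
  by rewrite inE/= in_itv/= => x01; rewrite /= ger0_norm// defect_ge0.
have Cae : {ae mu, forall w : R, 0 <= w <= 1 -> C u w = frechet a u w}.
  apply: lebesgue_aeS dae => w H w01; apply: defect_eq0 => //.
  by apply: EFin_inj; apply: H; rewrite /= in_itv.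
apply/eqP; rewrite -subr_eq0 -normr_le0; apply/ler_addgt0Pr => e e0; rewrite add0r.
(* One half for each of [C] and [frechet a], both 1-Lipschitz in the second argument. *)
have e2 : 0 < e / 2 by lra.
have [w [w01 vw Cw]] := ae_dense01 Cae v01 e2.
have := copula_dist copC u01 v01 w01.
have := copula_dist (is_copula_frechet a01) u01 v01 w01.
rewrite Cw => H1 H2.
rewrite (_ : C u v - _ = (C u v - frechet a u w) - (frechet a u v - frechet a u w)).
  by apply: le_trans (ler_normB _ _) _; lra.
by ring.
Qed.

End bound.

Theorem mainTheorem1 (R : realType) :
  (forall x : R, 0 <= x <= 1 ->
     (* the maximum sqrt x is attained by the Frechet copula with alpha = sqrt x *)
     [/\ is_copula (frechet (Num.sqrt x)),
         chatterjee_xi (frechet (Num.sqrt x)) = x,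
         footrule_psi (frechet (Num.sqrt x)) = Num.sqrt x,
     (* it is an upper bound *)
         (forall C, is_copula C -> chatterjee_xi C = x ->
            footrule_psi C <= Num.sqrt x) &
     (* and it is attained uniquely *)
         (forall C, is_copula C -> chatterjee_xi C = x ->
            footrule_psi C = Num.sqrt x ->
            forall u v, 0 <= u <= 1 -> 0 <= v <= 1 ->
              C u v = frechet (Num.sqrt x) u v)])
  /\ (forall C : R -> R -> R, is_copula C ->
        footrule_psi C <= Num.sqrt (chatterjee_xi C)).
Proof.
split; last exact: footrule_psi_le_sqrt_xi.
move=> x /andP[x0 x1]; have x2 : Num.sqrt x ^+ 2 = x by rewrite sqr_sqrtr.
have s01 : 0 <= Num.sqrt x <= 1.
  by rewrite sqrtr_ge0 -sqrtr1 ler_sqrt.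
split.
- exact: is_copula_frechet.
- by rewrite chatterjee_xi_frechet.
- exact: footrule_psi_frechet.
- by move=> C copC <-; exact: footrule_psi_le_sqrt_xi.
- move=> C copC xiE psiE; apply: footrule_psi_sqrt_xi_unique => //.
  by rewrite x2.
Qed.
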